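(* Let $r$ be an integer at least $5$. Then there exists $A\in\mathcal{COP}(\mathbb{S}_+^r)$ such that the polynomial $(\boldsymbol{X}\bullet\boldsymbol{X})^l\,q_A(\boldsymbol{X}^2)$ in $\boldsymbol{X}\in\mathbb{S}^r$ is not a sum of squares of polynomials for any nonnegative integer $l$. In other words, $\bigcup_{l\ge 0}\mathcal{I}_l(\mathbb{S}_+^r)$ is strictly included in $\mathcal{COP}(\mathbb{S}_+^r)$.
   Context: $\mathbb{S}^r$ is the space of real symmetric $r\times r$ matrices with inner product $\boldsymbol{X}\bullet\boldsymbol{Y}:=\mathrm{tr}(\boldsymbol{X}\boldsymbol{Y})$, and $\mathbb{S}_+^r$ is its cone of positive semidefinite matrices. $\boldsymbol{X}^2$ is the usual matrix square (equal to $\boldsymbol{X}\circ\boldsymbol{X}$ for the Jordan product $\boldsymbol{X}\circ\boldsymbol{Y}=(\boldsymbol{X}\boldsymbol{Y}+\boldsymbol{Y}\boldsymbol{X})/2$). $\mathcal{S}(\mathbb{S}^r)$ is the space of self-adjoint linear transformations on $(\mathbb{S}^r,\bullet)$, and for $A\in\mathcal{S}(\mathbb{S}^r)$, $q_A(\boldsymbol{X}):=\boldsymbol{X}\bullet A(\boldsymbol{X})$. The copositive cone over $\mathbb{S}_+^r$ is $\mathcal{COP}(\mathbb{S}_+^r):=\{A\in\mathcal{S}(\mathbb{S}^r)\mid q_A(\boldsymbol{X})\ge 0\ \forall\boldsymbol{X}\in\mathbb{S}_+^r\}$. With $n=\dim\mathbb{S}^r=r(r+1)/2$, $\Sigma^{n,2m}(\mathbb{S}^r)$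 is the cone of (finite) sums of squares of forms (homogeneous polynomials) of degree $m$ with real coefficients on $\mathbb{S}^r$. For each nonnegative integer $l$, $\mathcal{I}_l(\mathbb{S}_+^r):=\{A\in\mathcal{S}(\mathbb{S}^r)\mid(\boldsymbol{X}\bullet\boldsymbol{X})^l q_A(\boldsymbol{X}^2)\in\Sigma^{n,2(l+2)}(\mathbb{S}^r)\}$. *)

(* Defs.v *)
From mathcomp Require Export all_boot all_order all_algebra.
From mathcomp Require Export classical_sets reals.
From mathcomp Require Export mpoly.

Set Implicit Arguments.
Unset Strict Implicit.
Unset Printing Implicit Defensive.

Import GRing.Theory Num.Theory.

Local Open Scope ring_scope.
Local Open Scope classical_set_scope.

Section PolynomialsOnVectorSpace.
Variables (R : realType) (V : vectType R).
Implicit Types f : V -> R.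

(* Polynomials on V are real functions that are polynomial in the coordinates
   with respect to a basis of V (over an infinite field, this is the same as
   formal polynomials); the notions below do not depend on the choice of the
   basis. *)
Definition vcoord (v : V) (i : 'I_(\dim {: V})) : R :=
  coord (vbasis {: V}) i v.

Definition polynomial_on f : Prop :=
  exists p : {mpoly R[\dim {: V}]}, forall v, f v = p.@[vcoord v].

Definition form_on (d : nat) f : Prop :=
  exists2 p : {mpoly R[\dim {: V}]},
    p \is d.-homog & forall v, f v = p.@[vcoord v].

Definition sos_polynomials f : Prop :=
  exists (k : nat) (g : 'I_k -> V -> R),
    (forall i, polynomial_on (g i)) /\ forall v, f v = \sum_i g i v ^+ 2.

(* sums of squares of forms of degree m; their degree is 2m *)
Definition sos_forms (m : nat) f : Prop :=
  exists (k : nat) (g : 'I_k -> V -> R),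
    (forall i, form_on m (g i)) /\ forall v, f v = \sum_i g i v ^+ 2.

End PolynomialsOnVectorSpace.

Section SymmetricMatrices.
Variables (R : realType) (r : nat).

Definition symv : {vspace 'M[R]_r} := lker (linfun (@trmx R r r) - \1)%VF.

Lemma mem_symv (X : 'M[R]_r) : (X \in symv) = (X^T == X).
Proof.
by rewrite memv_ker add_lfunE opp_lfunE id_lfunE lfunE /= subr_eq0.
Qed.

Definition Sym : vectType R := subvs_of symv.

Definition mxval (X : Sym) : 'M[R]_r := vsval X.

Lemma trmx_mxval (X : Sym) : (mxval X)^T = mxval X.
Proof. by apply/eqP; rewrite -mem_symv subvsP. Qed.

Lemma sym_sqr_subproof (X : Sym) : mxval X *m mxval X \in symv.
Proof. by rewrite mem_symv trmx_mul trmx_mxval. Qed.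

Definition sym_sqr (X : Sym) : Sym := Subvs (sym_sqr_subproof X).

Definition sym_inner (X Y : Sym) : R := \tr (mxval X *m mxval Y).

Definition psd (X : Sym) : Prop :=
  forall v : 'cV[R]_r, 0 <= (v^T *m mxval X *m v) 0 0.

Definition self_adjoint (A : 'End(Sym)) : Prop :=
  forall X Y, sym_inner (A X) Y = sym_inner X (A Y).

Definition qform (A : 'End(Sym)) (X : Sym) : R := sym_inner X (A X).

Definition COP : set 'End(Sym) :=
  [set A | self_adjoint A /\ forall X, psd X -> 0 <= qform A X].

Definition lifted_qform (l : nat) (A : 'End(Sym)) (X : Sym) : R :=
  sym_inner X X ^+ l * qform A (sym_sqr X).

Definition Iapprox (l : nat) : set 'End(Sym) :=
  [set A | self_adjoint A /\ sos_forms (l + 2) (lifted_qform l A)].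

End SymmetricMatrices.

Arguments COP : clear implicits.
Arguments Iapprox : clear implicits.

(* Main.v *)
From HB Require Import structures.
From mathcomp Require Import complex sesquilinear spectral.
From mathcomp Require Import ring lra.
Require Import Defs.

(** The counterexample transplants the Horn form
      H(y) = (y_0 + ... + y_4)^2 - 4 (y_0 y_1 + y_1 y_2 + ... + y_4 y_0)
    to symmetric matrices. It is nonnegative on nonnegative vectors
    [horn_ge0], so that for all vectors w_i and weights m_i >= 0 the operator A
    with q_A(Y) = H(m_0 w_0^T Y w_0, ..., m_4 w_4^T Y w_4) is copositive over
    the positive semidefinite matrices, and q_A(X^2) is the value of H at the
    five numbers m_i |X w_i|^2.

    The multiplier (X . X)^l is disposed of by locality. Let R^5 be the span of
    the first five basis vectors of R^r. The five vectors w_i are chosen in its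
    4-dimensional hyperplane orthogonal to the all-ones vector 1; this is where
    the size r >= 5 enters. At the rank one matrix
    X = 1 1^T the polynomial then vanishes to order 4 in all directions Z with
    Z 1 = 0, and its leading part is a positive multiple of
    h(Z) = H(m_i |Z w_i|^2), whatever l is [lifted_horn_example]. If the
    polynomial were a sum of squares, then h would be a sum of squares of
    quadratic forms Q_k in Z [sos_leading_part].

    Let u_i be the projection of the basis vector e_i to that hyperplane,
    w_i = e_i - e_(i-1), U_i = u_i u_i^T and d_i = m_i - m_(i+1), with indices
    modulo 5. Then U_i only meets w_i and w_(i+1), so that on the plane spanned
    by U_i and U_(i+1) only three consecutive arguments of H are nonzero, and
    [horn_quartic_plane]
      h(a U_i + b U_(i+1))
        = (2/5 (2 d_i a^2 - m_(i+1) a b - 2 d_(i+1) b^2))^2.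
    For m_i = 9 + i the binary form on the right has positive discriminant.
    Every Q_k vanishes at its two real zeros, hence is proportional to it
    [binary_forms_proportional], and
      Q_k(U_(i+1)) / d_(i+1) = - Q_k(U_i) / d_i.
    Since the cycle has odd length, Q_k(U_0) = 0 [odd_cycle_vanish],
    contradicting h(U_0) = (4/5 d_0)^2 > 0.

    For the inclusion, a sum of squares gives q_A(Y^2) >= 0 for all symmetric Y
    at once, and every positive semidefinite matrix is such a square
    [psd_sqrt]. *)

Set Implicit Arguments.
Unset Strict Implicit.
Unset Printing Implicit Defensive.

Import Order.TTheory GRing.Theory Num.Theory.

Local Open Scope ring_scope.

(** * Square roots of positive semidefinite matrices *)

Lemma poly_interpolation (F : fieldType) (f : F -> F) (s : seq F) :
  exists p : {poly F}, forall x, x \in s -> p.[x] = f x.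
Proof.
elim: s => [|a s [p pE]]; first by exists 0.
pose q := \prod_(b <- s) ('X - b%:P).
have [as_|aNs] := boolP (a \in s).
  by exists p => x; rewrite inE => /orP[/eqP->|]; apply: pE.
have qa : q.[a] != 0 by rewrite -[_ == 0]/(root q a) root_prod_XsubC.
exists (p + ((f a - p.[a]) / q.[a])%:P * q) => x.
rewrite inE hornerD hornerM hornerC => /orP[/eqP->|xs].
  by rewrite divfK // addrC subrK.
have /eqP-> : root q x by rewrite root_prod_XsubC.
by rewrite mulr0 addr0 pE.
Qed.

Lemma psd_eigenvalue_ge0 (R : realType) (n : nat) (X : 'M[R]_n) (a : R) :
  (forall v : 'cV[R]_n, 0 <= (v^T *m X *m v) 0 0) -> eigenvalue X a -> 0 <= a.
Proof.
move=> Xpsd /eigenvalueP[v vX vN0].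
have := Xpsd v^T; rewrite trmxK vX -scalemxAl mxE.
suff v2 : 0 < (v *m v^T) 0 0 by rewrite pmulr_lge0.
have [j vj] : exists j, v 0 j != 0.
  apply/existsP; apply: contraNT vN0; rewrite negb_exists => /forallP v0.
  by apply/eqP/rowP => j; rewrite mxE; apply/eqP; have := v0 j; rewrite negbK.
rewrite mxE (bigD1 j) //= mxE ltr_pwDl //.
  by rewrite -expr2 exprn_even_gt0.
by apply: sumr_ge0 => k _; rewrite mxE -expr2 sqr_ge0.
Qed.

(** Over the algebraically closed field R[i] the spectral theorem yields a
    unitary, possibly non-real diagonalization.
    Writing the square root as a real polynomial in X, one that interpolates
    the real square root at the eigenvalues, keeps it real and symmetric; the
    diagonalization then only serves to check the identity Y^2 = X. *)
Lemma psd_sqrt (R : realType) (n : nat) (X : 'M[R]_n.+1) :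
  X^T = X -> (forall v : 'cV[R]_n.+1, 0 <= (v^T *m X *m v) 0 0) ->
  exists2 Y : 'M[R]_n.+1, Y^T = Y & Y *m Y = X.
Proof.
move=> Xsym Xpsd.
pose toC := real_complex R.
pose XC := map_mx toC X.
have XCsym : XC \is hermsymmx.
  apply: realsym_hermsym.
    apply/is_hermitianmxP; rewrite expr0 scale1r map_mx_id //.
    by rewrite /XC map_trmx Xsym.
  by apply/mxOverP => i j; rewrite mxE complex_real.
have /orthomx_spectralP := hermitian_normalmx XCsym.
have := hermitian_spectral_diag_real XCsym.
have := spectral_unit XC.
move: (spectralmx XC) (spectral_diag XC) => P d Punit dreal XCE.
have [a aE] : exists a : 'rV[R]_n.+1, d = map_mx toC a.
  exists (map_mx (@complex.Re R) d); apply/rowP => j; rewrite !mxE.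
  by have /mxOverP/(_ 0 j)/RRe_real := dreal.
have a_ge0 j : 0 <= a 0 j.
  apply: (psd_eigenvalue_ge0 Xpsd).
  rewrite eigenvalue_root_char -(fmorph_root toC) map_char_poly -/XC.
  rewrite -eigenvalue_root_char; apply/eigenvalueP; exists (row j P).
    (* The rows of the unitary matrix are left eigenvectors. *)
    rewrite XCE -row_mul !mulmxA mulmxV // mul1mx row_mul row_diag_mx aE mxE.
    by rewrite -scalemxAl -rowE.
  apply/eqP => Pj0; have : row j (P *m invmx P) = 0.
    by rewrite row_mul Pj0 mul0mx.
  rewrite mulmxV // => /rowP/(_ j); rewrite !mxE eqxx => /eqP.
  by rewrite oner_eq0.
have [p pE] := poly_interpolation Num.sqrt [seq a 0 j | j <- enum 'I_n.+1].
exists (horner_mx X p).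
  elim/poly_ind: p {pE} => [|q c IH]; first by rewrite rmorph0 linear0.
  rewrite rmorphD rmorphM /= horner_mx_X horner_mx_C linearD /= tr_scalar_mx.
  by rewrite trmx_mul Xsym IH; congr (_ + _); exact: comm_mx_horner.
apply: (map_mx_inj (f := toC)); rewrite map_mxM map_horner_mx -/XC XCE.
rewrite horner_mx_uconjC // !mulmxA mulmxK // -!mulmxA.
congr (_ *m _); rewrite mulmxA.
congr (_ *m _); rewrite horner_mx_diag mulmx_diag; congr diag_mx.
apply/rowP => j; rewrite aE !mxE horner_map -rmorphM /=.
rewrite pE -?expr2 ?sqr_sqrtr //.
by apply/mapP; exists j; rewrite ?mem_enum.
Qed.

(** * Leading parts of sums of squares *)

Lemma sum_sqr_eq0 (R : realDomainType) (I : finType) (F : I -> R) :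
  \sum_i F i ^+ 2 = 0 -> forall i, F i = 0.
Proof.
move=> /eqP; rewrite psumr_eq0 => [/allP F0 i|i _]; last exact: sqr_ge0.
by apply/eqP; rewrite -sqrf_eq0; apply: F0; rewrite mem_index_enum.
Qed.

Section Jets.
Variables (R : realType) (V : vectType R).
Implicit Types (f g L Q : V -> R) (e x y z : V).

Definition linear_form L : Prop :=
  forall a b x y, L (a *: x + b *: y) = a * L x + b * L y.

(** Being quadratic on each plane is all that is used of a quadratic form, and
    unlike a bilinear form it needs no choice of polarization. *)
Definition quadratic_on_planes Q : Prop :=
  forall x y, exists c, forall a b,
    Q (a *: x + b *: y) = a ^+ 2 * Q x + a * b * c + b ^+ 2 * Q y.

(** The second order Taylor expansion of f at e. Its coefficients are read off
    the restrictions of f to the lines through e, which are univariate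
    polynomials, so that no multivariate change of variables is needed. *)
Definition has_2jet e f : Prop :=
  exists (c : R) L Q, [/\ linear_form L, quadratic_on_planes Q &
    forall z, exists2 p : {poly R}, forall s, f (e + s *: z) = p.[s] &
      [/\ p`_0 = c, p`_1 = L z & p`_2 = Q z]].

Lemma has_2jet_cst e (c : R) : has_2jet e (fun=> c).
Proof.
exists c, (fun=> 0), (fun=> 0); split=> [a b x y|x y|z].
- by rewrite !mulr0 addr0.
- by exists 0 => a b; rewrite !mulr0 !addr0.
- by exists c%:P => [s|]; rewrite ?hornerC ?coefC.
Qed.

Lemma has_2jet_linear e L : linear_form L -> has_2jet e L.
Proof.
move=> Llin; exists (L e), L, (fun=> 0); split=> // [x y|z].
  by exists 0 => a b; rewrite !mulr0 !addr0.
exists ((L e)%:P + (L z)%:P * 'X) => [s|].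
  by rewrite -{1}[e]scale1r Llin !hornerE; ring.
by rewrite !coefD !coefMX !coefC /= addr0 !add0r.
Qed.

Lemma has_2jet_add e f g :
  has_2jet e f -> has_2jet e g -> has_2jet e (fun v => f v + g v).
Proof.
move=> [c [L [Q [Ll Qq fE]]]] [d [M [S [Ml Sq gE]]]].
exists (c + d), (fun z => L z + M z), (fun z => Q z + S z); split.
- by move=> a b x y; rewrite Ll Ml; ring.
- move=> x y; have [k kE] := Qq x y; have [l lE] := Sq x y.
  by exists (k + l) => a b; rewrite kE lE; ring.
- move=> z; have [p pE [p0 p1 p2]] := fE z; have [q qE [q0 q1 q2]] := gE z.
  exists (p + q) => [s|]; first by rewrite pE qE hornerD.
  by rewrite !coefD p0 p1 p2 q0 q1 q2.
Qed.

Lemma has_2jet_mul e f g :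
  has_2jet e f -> has_2jet e g -> has_2jet e (fun v => f v * g v).
Proof.
move=> [c [L [Q [Ll Qq fE]]]] [d [M [S [Ml Sq gE]]]].
exists (c * d), (fun z => c * M z + L z * d),
  (fun z => c * S z + L z * M z + Q z * d); split.
- by move=> a b x y; rewrite Ll Ml; ring.
- move=> x y; have [k kE] := Qq x y; have [l lE] := Sq x y.
  exists (c * l + k * d + L x * M y + L y * M x) => a b.
  by rewrite kE lE Ll Ml; ring.
- move=> z; have [p pE [p0 p1 p2]] := fE z; have [q qE [q0 q1 q2]] := gE z.
  exists (p * q) => [s|]; first by rewrite pE qE hornerM.
  rewrite !coefM !big_ord_recl !big_ord0 /= /bump /= !subnn ?subn0 ?addr0.
  by rewrite -?p0 -?p1 -?p2 -?q0 -?q1 -?q2 !addrA.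
Qed.

Lemma has_2jet_ext e f g : f =1 g -> has_2jet e g -> has_2jet e f.
Proof.
move=> fg [c [L [Q [? ? gE]]]]; exists c, L, Q; split=> // z.
by have [q qE ?] := gE z; exists q => // s; rewrite fg.
Qed.

(** The functions with a 2-jet at e form an algebra that contains the linear
    forms, hence all polynomials. *)
Lemma polynomial_has_2jet e f : polynomial_on f -> has_2jet e f.
Proof.
move=> [p /has_2jet_ext]; apply.
elim/mpolyind: p => [|c m p _ _ IH].
  by apply: has_2jet_ext (has_2jet_cst e 0) => v; rewrite meval0.
pose mono v := \prod_(i < \dim {: V}) vcoord v i ^+ m i.
apply: (@has_2jet_ext _ _ (fun v => c * mono v + p.@[vcoord v])) => [v|].
  by rewrite mevalD mevalZ mevalX.
apply: has_2jet_add => //; apply: has_2jet_mul; first exact: has_2jet_cst.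
rewrite /mono; elim: (index_enum _) => [|i s IHs].
  by apply: has_2jet_ext (has_2jet_cst e 1) => v; rewrite big_nil.
apply: has_2jet_ext => [v|]; first by rewrite big_cons.
apply: has_2jet_mul => //; elim: (m i) => [|k IHk].
  by apply: has_2jet_ext (has_2jet_cst e 1) => v; rewrite expr0.
apply: has_2jet_ext => [v|]; first by rewrite exprS.
apply: has_2jet_mul => //; apply: has_2jet_linear => a b x y.
by rewrite /vcoord linearD !linearZ.
Qed.

(** Squares of real polynomials cannot cancel in their lowest order: if a sum of
    squares is divisible by X^4, every summand is the square of a multiple of
    X^2. *)
Lemma sum_sqr_coef0 k (p : 'I_k -> {poly R}) (q : {poly R}) :
  \sum_i p i ^+ 2 = q * 'X^4 -> \sum_i (p i)`_2 ^+ 2 = q`_0.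
Proof.
move=> pq.
have coef j : \sum_i (p i ^+ 2)`_j = (q * 'X^4)`_j by rewrite -pq coef_sum.
have p0 : forall i, (p i)`_0 = 0.
  apply: sum_sqr_eq0; have := coef 0; rewrite coefMXn /=; apply: etrans.
  by apply: eq_bigr => i _; rewrite expr2 coefM big_ord1.
have p1 : forall i, (p i)`_1 = 0.
  apply: sum_sqr_eq0; have := coef 2; rewrite coefMXn /=; apply: etrans.
  apply: eq_bigr => i _; rewrite expr2 coefM !big_ord_recl big_ord0 /=.
  by rewrite !p0 !(mul0r, mulr0, add0r, addr0).
have := coef 4; rewrite coefMXn /= => <-.
apply: eq_bigr => i _; rewrite expr2 coefM !big_ord_recl big_ord0 /=.
by rewrite /bump /= !p0 !p1 !(mul0r, mulr0, add0r, addr0).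
Qed.

Lemma poly_eq_horner (p q : {poly R}) : (forall s, p.[s] = q.[s]) -> p = q.
Proof.
move=> pq; apply/eqP; rewrite -subr_eq0; apply/negPn/negP => pq0.
have := max_poly_roots pq0 (rs := [seq i%:R | i <- iota 0 (size (p - q))]).
rewrite size_map size_iota ltnn => F; suff: false by []; apply: F.
  by apply/allP => x _; rewrite /root hornerD hornerN pq subrr.
by rewrite map_inj_uniq ?iota_uniq // => i j /eqP; rewrite eqr_nat => /eqP.
Qed.

(** Leading parts inherit sums of squares: if f vanishes to order 4 at e in the
    directions z of W, with leading part h, then h is on W a sum of squares of
    the second order parts of the polynomials whose squares add up to f. *)
Lemma sos_leading_part f h (W : V -> Prop) (e : V) :
  sos_polynomials f ->
  (forall z, W z -> exists2 q : {poly R}, q`_0 = h z &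
     forall s, f (e + s *: z) = q.[s] * s ^+ 4) ->
  exists (k : nat) (Q : 'I_k -> V -> R),
    (forall i, quadratic_on_planes (Q i)) /\
    forall z, W z -> h z = \sum_i Q i z ^+ 2.
Proof.
move=> [k [g [gpol fE]]] fh; exists k.
have /fin_all_exists[c /fin_all_exists[L /fin_all_exists[Q QP]]] :
  forall i, has_2jet e (g i) by move=> i; apply: polynomial_has_2jet.
exists Q; split=> [i|z Wz]; first by have [] := QP i.
have /fin_all_exists2[p pE pc] : forall i, exists2 p : {poly R},
    forall s, g i (e + s *: z) = p.[s] & p`_2 = Q i z.
  by move=> i; have [_ _ /(_ z)[p ? []]] := QP i; exists p.
have [q <- qE] := fh z Wz.
rewrite -(@sum_sqr_coef0 _ p); first by apply: eq_bigr => i _; rewrite pc.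
apply: poly_eq_horner => s; rewrite hornerM hornerXn -qE fE horner_sum.
by apply: eq_bigr => i _; rewrite horner_exp pE.
Qed.

End Jets.

(** * Binary forms around an odd cycle *)

Section OddCycle.
Variable R : realType.

(** A binary quadratic form is determined up to a factor by two distinct real
    zeros. Only the ratio of the coefficients of a^2 and b^2 is recorded. *)
Lemma binary_forms_proportional (A B C D E F : R) :
  0 < E ^+ 2 - 4 * D * F -> D != 0 ->
  (forall a b, D * a ^+ 2 + E * (a * b) + F * b ^+ 2 = 0 ->
     a ^+ 2 * A + a * b * B + b ^+ 2 * C = 0) ->
  A * F = C * D.
Proof.
move=> disc D0 vanish; set s := Num.sqrt (E ^+ 2 - 4 * D * F).
have s2 : s ^+ 2 = E ^+ 2 - 4 * D * F by rewrite sqr_sqrtr // ltW.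
have s0 : s != 0 by rewrite sqrtr_eq0 -ltNge.
have root e : e ^+ 2 = E ^+ 2 - 4 * D * F ->
    (e - E) ^+ 2 * A + (e - E) * (2 * D) * B + (2 * D) ^+ 2 * C = 0.
  move=> e2; apply: vanish.
  transitivity (D * (e ^+ 2 - (E ^+ 2 - 4 * D * F))); first by ring.
  by rewrite e2 subrr mulr0.
(* The difference and the sum of the equations at the two zeros give the
   relations between A and B, and then between A and C. *)
have V1 := root s s2; have V2 : _ = 0 := root (- s) (etrans (sqrrN s) s2).
have AE : A * E = B * D.
  by apply: (mulfI s0); lra.
apply: (mulfI D0).
have : A * (s ^+ 2 + E ^+ 2) - 2 * E * (B * D) + 4 * D ^+ 2 * C = 0.
  by lra.
by rewrite -AE s2; lra.
Qed.

(** The quotient x / d changes sign at each of the five steps around the cycle,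
    hence equals its own opposite. *)
Lemma odd_cycle_vanish (x d : 'I_5 -> R) :
  (forall i, d i != 0) ->
  (forall i, x i * d (i + 1) = - (x (i + 1) * d i)) -> forall i, x i = 0.
Proof.
move=> d0 xd i.
have step j : x (j + 1) / d (j + 1) = - (x j / d j).
  have := xd j; move: (d0 j) (d0 (j + 1)); move: (x (j + 1)) (d (j + 1)) => y f.
  by move=> dj fj xf; apply/eqP; rewrite -mulNr eqr_div // mulNr xf opprK.
have : x i / d i = - (x i / d i).
  have i5 : i = i + 1 + 1 + 1 + 1 + 1.
    by rewrite -!addrA -[LHS]addr0; congr (_ + _); apply: val_inj.
  by rewrite {1 2}i5 !step !opprK.
move=> /eqP; rewrite -addr_eq0 -mulr2n mulrn_eq0 /= mulf_eq0 invr_eq0.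
by rewrite (negPf (d0 i)) orbF => /eqP.
Qed.

End OddCycle.

(** * The Horn form *)

Section Horn.
Variable R : realType.
Implicit Types y : 'I_5 -> R.

(** The Horn form, with indices taken cyclically in Z/5. *)
Definition horn y : R := (\sum_i y i) ^+ 2 - 4 * \sum_i y i * y (i + 1).

(** The indices are spelled as iterated additions of 1, so that the cyclic
    successor of an index in this list is syntactically the next one, up to
    the wrap-around 5 = 0. *)
Lemma big_I5 (F : 'I_5 -> R) :
  \sum_i F i = F 0 + F 1 + F (1 + 1) + F (1 + 1 + 1) + F (1 + 1 + 1 + 1).
Proof.
rewrite !big_ord_recl big_ord0 addr0 !addrA.
by do !congr (_ + _); congr F; apply: val_inj.
Qed.

Lemma I5_ind (P : 'I_5 -> Prop) :
  P 0 -> P 1 -> P (1 + 1) -> P (1 + 1 + 1) -> P (1 + 1 + 1 + 1) ->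
  forall i, P i.
Proof.
move=> P0 P1 P2 P3 P4 [[|[|[|[|[|//]]]]] lti].
- by rewrite (_ : Ordinal lti = 0) //; apply: val_inj.
- by rewrite (_ : Ordinal lti = 1) //; apply: val_inj.
- by rewrite (_ : Ordinal lti = 1 + 1) //; apply: val_inj.
- by rewrite (_ : Ordinal lti = 1 + 1 + 1) //; apply: val_inj.
- by rewrite (_ : Ordinal lti = 1 + 1 + 1 + 1) //; apply: val_inj.
Qed.

Lemma I5_wrap : 1 + 1 + 1 + 1 + 1 = 0 :> 'I_5. Proof. exact: val_inj. Qed.

(** The form is written in two ways as a square plus products. All factors of
    the products are nonnegative entries except for a difference of the last two
    entries, whose sign decides which of the two to use. *)
Lemma horn_ge0 y : (forall i, 0 <= y i) -> 0 <= horn y.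
Proof.
move=> y0; rewrite /horn !big_I5 add0r I5_wrap.
have := (y0 0, y0 1, y0 (1 + 1), y0 (1 + 1 + 1), y0 (1 + 1 + 1 + 1)).
move: (y 0) (y 1) (y (1 + 1)) (y (1 + 1 + 1)) (y (1 + 1 + 1 + 1)).
move=> a b c d e [[[[a0 b0] c0] d0] e0].
have [de|/ltW ed] := leP d e.
  rewrite [leRHS](_ : _ = (a - b + c + d - e) ^+ 2 + 4 * (b * d + c * (e - d))).
    by rewrite addr_ge0 ?sqr_ge0 // mulr_ge0 // addr_ge0 // mulr_ge0 //
      subr_ge0.
  by ring.
rewrite [leRHS](_ : _ = (a - b + c - d + e) ^+ 2 + 4 * (b * e + a * (d - e))).
  by rewrite addr_ge0 ?sqr_ge0 // mulr_ge0 // addr_ge0 // mulr_ge0 // subr_ge0.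
by ring.
Qed.

Lemma hornZ c y : horn (fun i => c * y i) = c ^+ 2 * horn y.
Proof. by rewrite /horn !big_I5; ring. Qed.

(** On three cyclically consecutive coordinates the Horn form is a perfect
    square whose root gives the middle coordinate the opposite sign; this is
    the source of the sign change along the 5-cycle. *)
Lemma horn_three i y :
  (forall j, j != i -> j != i + 1 -> j != i + 1 + 1 -> y j = 0) ->
  horn y = (y i - y (i + 1) + y (i + 1 + 1)) ^+ 2.
Proof.
move=> y0; rewrite /horn !big_I5 add0r I5_wrap.
elim/I5_ind: i y0 => y0.
- by rewrite (y0 (1 + 1 + 1)) // (y0 (1 + 1 + 1 + 1)) // ?add0r; ring.
- by rewrite (y0 0) // (y0 (1 + 1 + 1 + 1)) //; ring.
- by rewrite (y0 0) // (y0 1) //; ring.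
- by rewrite !I5_wrap (y0 1) // (y0 (1 + 1)) //; ring.
- by rewrite !I5_wrap !add0r (y0 (1 + 1)) // (y0 (1 + 1 + 1)) //; ring.
Qed.

End Horn.

(** * Vectors, rank one matrices and the trace inner product *)

Section Dot.
Variables (R : realType) (r : nat).
Implicit Types (u v w : 'cV[R]_r) (X Y Z : Sym R r).

Definition dot u v : R := (u^T *m v) 0 0.

Lemma dotC u v : dot u v = dot v u.
Proof. by rewrite /dot -[in RHS](trmxK u) -trmx_mul [RHS]mxE. Qed.

Lemma dotDr u v w : dot u (v + w) = dot u v + dot u w.
Proof. by rewrite /dot mulmxDr mxE. Qed.

Lemma dotZr a u v : dot u (a *: v) = a * dot u v.
Proof. by rewrite /dot -scalemxAr mxE. Qed.

Lemma dotNr u v : dot u (- v) = - dot u v.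
Proof. by rewrite -scaleN1r dotZr mulN1r. Qed.

Lemma dotDl u v w : dot (v + w) u = dot v u + dot w u.
Proof. by rewrite !(dotC _ u) dotDr. Qed.

Lemma dotZl a u v : dot (a *: v) u = a * dot v u.
Proof. by rewrite !(dotC _ u) dotZr. Qed.

Lemma dotNl u v : dot (- v) u = - dot v u.
Proof. by rewrite !(dotC _ u) dotNr. Qed.

Lemma dot_sumr (I : finType) u (F : I -> 'cV[R]_r) :
  dot u (\sum_i F i) = \sum_i dot u (F i).
Proof. by rewrite /dot mulmx_sumr summxE. Qed.

Definition dotE := (dotDl, dotDr, dotZl, dotZr, dotNl, dotNr).

Lemma dot_sqr_lincomb a b u v : dot (a *: u + b *: v) (a *: u + b *: v) =
  a ^+ 2 * dot u u + 2 * (a * b) * dot u v + b ^+ 2 * dot v v.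
Proof. by rewrite !dotE (dotC v u); ring. Qed.

Lemma rank1_subproof u : u *m u^T \in symv R r.
Proof. by rewrite mem_symv trmx_mul trmxK. Qed.

Definition rank1 u : Sym R r := Subvs (rank1_subproof u).

Lemma rank1_mul u v : mxval (rank1 u) *m v = dot u v *: u.
Proof. by rewrite -mulmxA (mx11_scalar (u^T *m v)) mul_mx_scalar. Qed.

Lemma mxvalD X Y : mxval (X + Y) = mxval X + mxval Y. Proof. by []. Qed.
Lemma mxvalZ a X : mxval (a *: X) = a *: mxval X. Proof. by []. Qed.

Lemma innerC X Y : sym_inner X Y = sym_inner Y X.
Proof. exact: mxtrace_mulC. Qed.

Lemma innerDr X Y Z : sym_inner X (Y + Z) = sym_inner X Y + sym_inner X Z.
Proof. by rewrite /sym_inner mxvalD mulmxDr mxtraceD. Qed.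

Lemma innerZr a X Y : sym_inner X (a *: Y) = a * sym_inner X Y.
Proof. by rewrite /sym_inner mxvalZ -scalemxAr mxtraceZ. Qed.

Lemma innerZl a X Y : sym_inner (a *: X) Y = a * sym_inner X Y.
Proof. by rewrite !(innerC _ Y) innerZr. Qed.

Lemma inner0r X : sym_inner X 0 = 0.
Proof. by rewrite -(scale0r 0) innerZr mul0r. Qed.

Lemma inner_sumr (I : finType) X (F : I -> Sym R r) :
  sym_inner X (\sum_i F i) = \sum_i sym_inner X (F i).
Proof.
elim/big_rec2: _ => [|i a S _ <-]; first exact: inner0r.
by rewrite innerDr.
Qed.

Lemma inner_rank1 u X : sym_inner (rank1 u) X = dot u (mxval X *m u).
Proof. by rewrite /sym_inner -mulmxA mxtrace_mulC trace_mx11 /dot mulmxA. Qed.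

Lemma inner_self_ge0 X : 0 <= sym_inner X X.
Proof.
rewrite /sym_inner -{1}trmx_mxval; apply: sumr_ge0 => i _; rewrite mxE.
by apply: sumr_ge0 => j _; rewrite mxE -expr2 sqr_ge0.
Qed.

Lemma inner_self_eq0 X : sym_inner X X = 0 -> X = 0.
Proof.
have sq0 (a : R) : 0 <= a * a by rewrite -expr2 sqr_ge0.
rewrite /sym_inner -{1}trmx_mxval => /eqP; rewrite psumr_eq0; last first.
  by move=> i _; rewrite mxE; apply: sumr_ge0 => j _; rewrite mxE.
move=> /allP X0; apply: val_inj; apply/matrixP => j i; rewrite [RHS]mxE.
have := X0 i (mem_index_enum _); rewrite mxE psumr_eq0; last first.
  by move=> k _; rewrite mxE.
by move=> /allP/(_ j (mem_index_enum _)); rewrite mxE mulf_eq0 orbb => /eqP.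
Qed.

Lemma inner_ext X Y : (forall Z, sym_inner Z X = sym_inner Z Y) -> X = Y.
Proof.
move=> XY; apply/eqP; rewrite -subr_eq0; apply/eqP/inner_self_eq0.
by rewrite innerDr -scaleN1r innerZr XY mulN1r subrr.
Qed.

Section HornOperator.
Variable P : 'I_5 -> Sym R r.

(** The self-adjoint operator whose quadratic form is the Horn form evaluated at
    the five linear functionals Y |-> P i . Y. *)
Definition horn_op Y : Sym R r :=
  (\sum_i sym_inner (P i) Y) *: (\sum_i P i) - 2 *:
  \sum_i (sym_inner (P i) Y *: P (i + 1) + sym_inner (P (i + 1)) Y *: P i).

Lemma inner_horn_op X Y : sym_inner X (horn_op Y) =
  (\sum_i sym_inner (P i) Y) * (\sum_i sym_inner (P i) X) -
    2 * \sum_i (sym_inner (P i) Y * sym_inner (P (i + 1)) X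
                 + sym_inner (P (i + 1)) Y * sym_inner (P i) X).
Proof.
rewrite /horn_op -scaleNr innerDr !innerZr !inner_sumr mulNr.
congr (_ * _ - _ * _); apply: eq_bigr => i _; first by rewrite innerC.
by rewrite innerDr !innerZr !(innerC X).
Qed.

Fact horn_op_is_linear : linear horn_op.
Proof.
move=> a X Y; apply: inner_ext => Z.
rewrite [RHS]innerDr innerZr !inner_horn_op.
by rewrite !big_I5 !innerDr !innerZr; ring.
Qed.

HB.instance Definition _ :=
  GRing.isLinear.Build R (Sym R r) (Sym R r) *:%R horn_op horn_op_is_linear.

Lemma horn_op_self_adjoint : self_adjoint (linfun horn_op).
Proof.
move=> X Y; rewrite !lfunE /= innerC !inner_horn_op !big_I5; ring.
Qed.

Lemma qform_horn_op X :
  qform (linfun horn_op) X = horn (fun i => sym_inner (P i) X).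
Proof. by rewrite /qform lfunE inner_horn_op /horn !big_I5; ring. Qed.

End HornOperator.

End Dot.

(** * The counterexample *)

Section HornExample.
Variables (R : realType) (n : nat).
Local Notation r := (5 + n)%N.

Definition basis5 (i : 'I_5) : 'cV[R]_r := delta_mx (lshift n i) 0.
Definition ones5 : 'cV[R]_r := \sum_i basis5 i.

(** The projection of a basis vector onto the orthogonal complement of ones5 in
    the span of the basis: five vectors of a 4-dimensional space. *)
Definition centred (i : 'I_5) := basis5 i - 5^-1 *: ones5.

(** Up to scaling, the only vector of that 4-dimensional space that is
    orthogonal to all centred vectors but the cyclically consecutive ones of
    indices i - 1 and i. *)
Definition difference (i : 'I_5) := basis5 i - basis5 (i - 1).

(** Consecutive weights must differ, yet by little compared with their size, for
    the discriminants in horn_example_not_sos to be positive. *)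
Definition weight (i : 'I_5) : R := (9 + i)%N%:R.

Lemma dot_basis5 i j : dot (basis5 i) (basis5 j) = (i == j)%:R.
Proof.
by rewrite /dot trmx_delta -rowE !mxE (inj_eq (@lshift_inj _ _)) andbT.
Qed.

Lemma dot_basis5_ones i : dot (basis5 i) ones5 = 1.
Proof.
rewrite dot_sumr (bigD1 i) //= dot_basis5 eqxx big1 ?addr0 // => j.
by rewrite dot_basis5 eq_sym => /negPf->.
Qed.

Lemma dot_ones_ones : dot ones5 ones5 = 5.
Proof.
rewrite {2}/ones5 dot_sumr (eq_bigr (fun=> 1)) => [|i _].
  by rewrite sumr_const card_ord.
by rewrite dotC dot_basis5_ones.
Qed.

Lemma dot_centred_ones i : dot (centred i) ones5 = 0.
Proof.
by rewrite !dotE dot_basis5_ones dot_ones_ones mulVf ?subrr ?pnatr_eq0.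
Qed.

Lemma dot_difference_ones i : dot ones5 (difference i) = 0.
Proof. by rewrite !dotE !(dotC ones5) !dot_basis5_ones subrr. Qed.

Lemma dot_centred i j : dot (centred i) (centred j) = (i == j)%:R - 5^-1.
Proof.
rewrite {2}/centred dotDr dotNr dotZr dot_centred_ones mulr0 subr0.
by rewrite !dotE dot_basis5 (dotC ones5) dot_basis5_ones mulr1.
Qed.

Lemma dot_centred_difference i j :
  dot (centred i) (difference j) = (i == j)%:R - (i + 1 == j)%:R.
Proof.
rewrite {1}/centred dotDl dotNl dotZl dot_difference_ones mulr0 subr0.
rewrite !dotE !dot_basis5 (eq_sym i (j - 1)) subr_eq.
by rewrite eq_sym (eq_sym j (i + 1)).
Qed.

Definition horn_example : 'End(Sym R r) :=
  linfun (horn_op (fun i => weight i *: rank1 (difference i))).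

(** This is q_A(Z^2) for A = horn_example: since Z is symmetric, w^T Z^2 w is
    the squared length of Z w. *)
Definition horn_quartic (Z : Sym R r) : R :=
  let Zw i := mxval Z *m difference i in
  horn (fun i => weight i * dot (Zw i) (Zw i)).

Lemma weightE : [/\ weight 0 = 9, weight 1 = 10, weight (1 + 1) = 11,
  weight (1 + 1 + 1) = 12 & weight (1 + 1 + 1 + 1) = 13].
Proof. by []. Qed.

Lemma weight_gt0 i : 0 < weight i. Proof. by rewrite ltr0n. Qed.

Lemma horn_example_COP : COP R r horn_example.
Proof.
split; first exact: horn_op_self_adjoint.
move=> X Xpsd; rewrite qform_horn_op; apply: horn_ge0 => i.
by rewrite innerZl inner_rank1 /dot mulmxA mulr_ge0 ?Xpsd // ltW ?weight_gt0.
Qed.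

Lemma qform_horn_example_sqr Z :
  qform horn_example (sym_sqr Z) = horn_quartic Z.
Proof.
rewrite qform_horn_op /horn_quartic /horn !big_I5.
have E i : sym_inner (weight i *: rank1 (difference i)) (sym_sqr Z) =
   weight i * dot (mxval Z *m difference i) (mxval Z *m difference i).
  rewrite innerZl inner_rank1 /dot trmx_mul trmx_mxval -!mulmxA.
  by congr (_ * (_ *m _) _ _); rewrite mulmxA.
by rewrite !E.
Qed.

(** Along Z with Z ones5 = 0, the vectors w_i only see the perturbation s Z,
    since they are orthogonal to ones5. So q_A contributes s^4 times the quartic
    form of Z, while the multiplier has the nonzero value 25^l at s = 0. *)
Lemma lifted_horn_example (l : nat) (Z : Sym R r) : mxval Z *m ones5 = 0 ->
  exists2 q : {poly R}, q`_0 = 25 ^+ l * horn_quartic Z &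
    forall s,
      lifted_qform l horn_example (rank1 ones5 + s *: Z) = q.[s] * s ^+ 4.
Proof.
move=> Z1.
exists ((25%:P + (sym_inner Z Z)%:P * 'X^2) ^+ l * (horn_quartic Z)%:P).
  by rewrite -horner_coef0 !hornerE /= mulr0 addr0.
move=> s; rewrite /lifted_qform qform_horn_example_sqr.
have -> : sym_inner (rank1 ones5 + s *: Z) (rank1 ones5 + s *: Z) =
    25 + sym_inner Z Z * s ^+ 2.
  have dot0 : dot ones5 0 = 0 by rewrite /dot mulmx0 mxE.
  rewrite innerDr innerZr !(innerC (_ + _)) !innerDr !innerZr (innerC Z).
  by rewrite !inner_rank1 Z1 dot0 rank1_mul dotZr dot_ones_ones; ring.
have -> : horn_quartic (rank1 ones5 + s *: Z) = s ^+ 4 * horn_quartic Z.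
  rewrite (_ : s ^+ 4 = (s ^+ 2) ^+ 2); last by rewrite -exprM.
  rewrite -hornZ /horn_quartic /horn !big_I5.
  have E i : mxval (rank1 ones5 + s *: Z) *m difference i =
      s *: (mxval Z *m difference i).
    rewrite mxvalD mulmxDl rank1_mul dot_difference_ones scale0r add0r.
    by rewrite mxvalZ -scalemxAl.
  by rewrite !E !dotE; ring.
by rewrite !hornerE /=; ring.
Qed.

(** The matrix of index i only meets the differences of indices i and i + 1, so
    only the coordinates i, i + 1 and i + 2 of the Horn form are nonzero, and it
    is a square. *)
Lemma horn_quartic_plane (i : 'I_5) (a b : R) :
  horn_quartic (a *: rank1 (centred i) + b *: rank1 (centred (i + 1))) =
  (2 / 5 * (2 * (weight i - weight (i + 1)) * a ^+ 2 - weight (i + 1) * (a * b)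
     - 2 * (weight (i + 1) - weight (i + 1 + 1)) * b ^+ 2)) ^+ 2.
Proof.
set Z := (_ + _).
have Zw j : mxval Z *m difference j =
   (a * ((i == j)%:R - (i + 1 == j)%:R)) *: centred i +
   (b * ((i + 1 == j)%:R - (i + 1 + 1 == j)%:R)) *: centred (i + 1).
  rewrite mxvalD !mxvalZ mulmxDl -!scalemxAl !rank1_mul.
  by rewrite !dot_centred_difference !scalerA.
rewrite /horn_quartic (@horn_three _ i); last first.
  move=> j ji ji1 ji2; rewrite Zw !(eq_sym _ j).
  by rewrite (negPf ji) (negPf ji1) (negPf ji2) subrr !mulr0 !scale0r addr0
    /dot mulmx0 mxE mulr0.
have neq1 (k : 'I_5) : (k == k + 1) = false by elim/I5_ind: k.
have neq2 (k : 'I_5) : (k == k + 1 + 1) = false by elim/I5_ind: k.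
have ne01 := neq1 i; have ne12 := neq1 (i + 1); have ne02 := neq2 i.
have ne10 : (i + 1 == i) = false by rewrite eq_sym.
have ne21 : (i + 1 + 1 == i + 1) = false by rewrite eq_sym.
have ne20 : (i + 1 + 1 == i) = false by rewrite eq_sym.
rewrite !Zw !eqxx ne01 ne02 ne12 ne10 ne20 ne21.
by rewrite !dot_sqr_lincomb !dot_centred !eqxx ne01 /=; field.
Qed.

(** The Horn obstruction: on each plane spanned by consecutive U i, a quadratic
    form occurring in the sum of squares is proportional to the indefinite form
    whose square is the quartic. This relates its values at U i and U (i + 1)
    with a sign, and the signs are incompatible along a 5-cycle; so the quartic
    would vanish at U 0. *)
Lemma horn_example_not_sos l : ~ sos_polynomials (lifted_qform l horn_example).
Proof.
move=> sos.
pose W (Z : Sym R r) : Prop := mxval Z *m ones5 = 0.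
have [|k [Q [Qquad QE]]] := sos_leading_part (W := W) (e := rank1 ones5)
    (h := fun Z => 25 ^+ l * horn_quartic Z) sos.
  by move=> Z WZ; apply: lifted_horn_example.
pose U i := rank1 (centred i); pose d i := weight i - weight (i + 1).
have planeW i a b : W (a *: U i + b *: U (i + 1)).
  rewrite /W mxvalD !mxvalZ mulmxDl -!scalemxAl !rank1_mul !dot_centred_ones.
  by rewrite !scale0r !scaler0 addr0.
have d0 i : d i != 0.
  by rewrite subr_eq0 eqr_nat eqn_add2l; elim/I5_ind: i.
have QU j i : Q j (U i) = 0.
  move: i; apply: (@odd_cycle_vanish _ _ d) => // i.
  have [B QB] := Qquad j (U i) (U (i + 1)).
  have disc : 0 < (- weight (i + 1)) ^+ 2 - 4 * (2 * d i) * (- (2 * d (i + 1))).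
    have [w0 w1 w2 w3 w4] := weightE.
    rewrite /d; elim/I5_ind: i {QB};
      by rewrite ?I5_wrap ?add0r ?w0 ?w1 ?w2 ?w3 ?w4; lra.
  have D0 : 2 * d i != 0 by rewrite mulf_neq0 ?pnatr_eq0.
  have prop := binary_forms_proportional
    (A := Q j (U i)) (B := B) (C := Q j (U (i + 1))) disc D0.
  suff: Q j (U i) * - (2 * d (i + 1)) = Q j (U (i + 1)) * (2 * d i) by lra.
  (* At a zero of the indefinite form the quartic vanishes, and with it every
     quadratic form of the sum of squares. *)
  apply: prop => a b ab0; rewrite -QB; move: j {QB}; apply: sum_sqr_eq0.
  rewrite -QE // horn_quartic_plane [X in _ * X](_ : _ = 0) ?expr0n ?mulr0 //.
  rewrite [X in 2 / 5 * X](_ : _ = 0) ?mulr0 ?expr0n //.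
  by rewrite -[RHS]ab0 /d; ring.
have := QE (1 *: U 0 + 0 *: U (0 + 1)) (planeW 0 1 0).
rewrite big1 => [|j _]; last by rewrite scale1r scale0r addr0 QU expr0n.
rewrite horn_quartic_plane => /eqP.
have [w0 w1 w2 _ _] := weightE; rewrite !add0r w0 w1 w2.
rewrite mulf_eq0 sqrf_eq0 expf_eq0 => /orP[|].
  by rewrite pnatr_eq0 andbF.
by apply/negP/eqP; lra.
Qed.

End HornExample.

(** * Strict inclusion *)

Local Open Scope classical_set_scope.

Theorem theorem5p4 (R : realType) (r : nat) (hr : (5 <= r)%N) :
  (exists2 A : 'End(Sym R r),
     COP R r A &
     forall l : nat, ~ sos_polynomials (lifted_qform l A)) /\
  \bigcup_l Iapprox R r l `<` COP R r.
Proof.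
have [n ->] : exists n, r = (5 + n)%N by exists (r - 5)%N; rewrite subnKC.
have notsos := @horn_example_not_sos R n.
split; first by exists (horn_example R n) => //; exact: horn_example_COP.
split=> [A [l _ [Asa [k [g [_ gE]]]]]|sub]; last first.
  have [l _ [_ [k [g [gform gE]]]]] := sub _ (horn_example_COP R n).
  apply: (notsos l); exists k, g; split=> // i.
  by have [p _ pE] := gform i; exists p.
split=> // X Xpsd.
(* Sums of squares only control q_A on the squares of symmetric matrices, hence
   the square root. *)
have [Y Ysym YX] := @psd_sqrt R (4 + n) (mxval X) (trmx_mxval X) Xpsd.
have Ymem : Y \in symv R (5 + n) by rewrite mem_symv Ysym.
have -> : X = sym_sqr (Subvs Ymem) by apply: val_inj.
move: (Subvs Ymem) => Z.
have := gE Z; have [->|Z0] := eqVneq Z 0.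
  rewrite (_ : sym_sqr 0 = 0); last by apply: val_inj; exact: mulmx0.
  by rewrite /qform innerC inner0r.
have Zpos : 0 < sym_inner Z Z.
  rewrite lt_def inner_self_ge0 andbT.
  by apply: contra_neq Z0 => /inner_self_eq0.
rewrite /lifted_qform => E.
rewrite -(pmulr_rge0 _ (exprn_gt0 l Zpos)) E.
by apply: sumr_ge0 => i _; exact: sqr_ge0.
Qed.
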